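(* Let $\mathbb K$ be a field, let $M$ be a finitely generated, commutative, torsion-free and cancellative binoid, and let $i:\operatorname{Spec}M\to\operatorname{Spec}\mathbb K[M]$, $\mathfrak p\mapsto\mathbb K[\mathfrak p]$, where both spaces carry their Zariski topologies. Then the pushforward of sheaves of abelian groups along $i$ is exact: for every short exact sequence $0\to\mathscr F\to\mathscr G\to\mathscr H\to0$ of sheaves of abelian groups on $\operatorname{Spec}M$, the sequence $0\to i_*\mathscr F\to i_*\mathscr G\to i_*\mathscr H\to0$ of sheaves on $\operatorname{Spec}\mathbb K[M]$ is exact.
   Context: A binoid $(M,+,0,\infty)$ is a commutative monoid with an absorbing element $\infty$. $M$ is cancellative if $a+x=a+y\neq\infty$ implies $x=y$; torsion-free if $nx=ny\ne\infty$ for some $n\ge1$ implies $x=y$. An ideal is a subset $I\ni\infty$ with $M+I\subseteq I$; it is prime if $I\ne M$ and $a+b\in I$ implies $a\in I$ or $b\in I$. $\operatorname{Spec}M$ is the set of prime ideals with the (Zariski) topology having basis $D(f)=\{\mathfrak p\mid f\notin\mathfrak p\}$, $f\in M$. $\mathbb K[M]$ is the $\mathbb K$-algebra with $\mathbb K$-basis $T^\mu$, $\mu\in M\setminus\{\infty\}$, multiplication $T^\mu T^\nu=T^{\mu+\nu}$, and $T^\infty=0$. For an ideal $I\subseteq M$, $\mathbb K[I]$ is the ideal of $\mathbb K[M]$ spanned by $T^\mu$, $\mu\in I$. Under these hypotheses $\mathbb K[\mathfrak p]$ is prime whenever $\mathfrak p$ is, and $i$ is continuous. *)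

(* Defs.v *)
From HB Require Import structures.
From mathcomp Require Import all_boot all_order all_algebra finmap.
From mathcomp Require Import monalg.
From mathcomp Require Import boolp classical_sets functions.
From mathcomp Require Import topology.

Set Implicit Arguments.
Unset Strict Implicit.
Unset Printing Implicit Defensive.

Import GRing.Theory.

Local Open Scope classical_set_scope.
Local Open Scope ring_scope.

HB.mixin Record Nmodule_isBinoid M of GRing.Nmodule M := {
  infty : M;
  addr_infty : forall x : M, x + infty = infty
}.

#[short(type="binoidType")]
HB.structure Definition Binoid := {M of GRing.Nmodule M & Nmodule_isBinoid M}.

Arguments infty {s}.

Section BinoidNotions.
Variable M : binoidType.

Definition cancellative :=
  forall a x y : M, a + x = a + y -> a + y <> infty -> x = y.

Definition torsion_free :=
  forall (n : nat) (x y : M),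
    (1 <= n)%N -> x *+ n = y *+ n -> y *+ n <> infty -> x = y.

(* infty itself need not be a sum of generators: it is an operation of binoids,
   and adding it to s would make no difference. *)
Definition finitely_generated :=
  exists s : seq M, forall x : M, x <> infty ->
    exists c : M -> nat, x = \sum_(a <- s) a *+ c a.

Definition binoid_ideal (I : set M) :=
  I infty /\ forall a x, I x -> I (a + x).

Definition binoid_prime (I : set M) :=
  [/\ binoid_ideal I, I <> setT & forall a b, I (a + b) -> I a \/ I b].

End BinoidNotions.

Arguments cancellative M : clear implicits.
Arguments torsion_free M : clear implicits.
Arguments finitely_generated M : clear implicits.

Section RingNotions.
Variable R : comPzRingType.

Definition ring_ideal (I : set R) :=
  [/\ I 0, forall x y, I x -> I y -> I (x + y) & forall a x, I x -> I (a * x)].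

Definition ring_prime (I : set R) :=
  [/\ ring_ideal I, I <> setT & forall a b, I (a * b) -> I a \/ I b].

End RingNotions.

Record binoid_spec (M : binoidType) := BinoidSpec {
  binoid_spec_set :> M -> Prop;
  binoid_specP : binoid_prime binoid_spec_set
}.

Record ring_spec (R : comPzRingType) := RingSpec {
  ring_spec_set :> R -> Prop;
  ring_specP : ring_prime ring_spec_set
}.

Section BinoidSpecTopology.
Variable M : binoidType.

HB.instance Definition _ := gen_eqMixin (binoid_spec M).
HB.instance Definition _ := gen_choiceMixin (binoid_spec M).

Definition binoid_D (f : M) : set (binoid_spec M) := [set p : binoid_spec M | ~ p f].

Lemma binoid_prime_n0 (p : binoid_spec M) : ~ p 0.
Proof.
have [[_ pI] pT _] := binoid_specP p => p0; apply: pT; apply/seteqP; split=> // x _.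
by rewrite -(addr0 x); apply: pI.
Qed.

Lemma binoid_D0 : binoid_D 0 = setT.
Proof. by apply/seteqP; split=> // p _; exact: binoid_prime_n0. Qed.

Lemma binoid_DD f g : binoid_D (f + g) = binoid_D f `&` binoid_D g.
Proof.
apply/seteqP; split=> p /=; have [[_ pI] pT pp] := binoid_specP p.
- by move=> pfg; split=> H; apply: pfg; [rewrite addrC|]; apply: pI.
- by case=> pf pg /pp[].
Qed.

Lemma binoid_D_cover : \bigcup_(U in range binoid_D) U = setT.
Proof.
apply/seteqP; split=> // p _.
by exists (binoid_D 0); [exists 0|exact: binoid_prime_n0].
Qed.

Lemma binoid_D_join (U V : set (binoid_spec M)) p :
  range binoid_D U -> range binoid_D V -> U p -> V p ->
  exists W, [/\ range binoid_D W, W p & W `<=` U `&` V].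
Proof.
move=> [f _ <-] [g _ <-] pf pg; exists (binoid_D (f + g)); split.
- by exists (f + g).
- by rewrite binoid_DD.
- by rewrite binoid_DD.
Qed.

HB.instance Definition _ :=
  isBaseTopological.Build (binoid_spec M) binoid_D_cover binoid_D_join.

End BinoidSpecTopology.

Section RingSpecTopology.
Variable R : comPzRingType.

HB.instance Definition _ := gen_eqMixin (ring_spec R).
HB.instance Definition _ := gen_choiceMixin (ring_spec R).

Definition ring_D (f : R) : set (ring_spec R) := [set p : ring_spec R | ~ p f].

Lemma ring_prime_n1 (p : ring_spec R) : ~ p 1.
Proof.
have [[_ _ pI] pT _] := ring_specP p => p1; apply: pT; apply/seteqP; split=> // x _.
by rewrite -(mulr1 x); apply: pI.
Qed.

Lemma ring_DM f g : ring_D (f * g) = ring_D f `&` ring_D g.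
Proof.
apply/seteqP; split=> p /=; have [[_ _ pI] pT pp] := ring_specP p.
- by move=> pfg; split=> H; apply: pfg; [rewrite mulrC|]; apply: pI.
- by case=> pf pg /pp[].
Qed.

Lemma ring_D_cover : \bigcup_(U in range ring_D) U = setT.
Proof.
apply/seteqP; split=> // p _.
by exists (ring_D 1); [exists 1|exact: ring_prime_n1].
Qed.

Lemma ring_D_join (U V : set (ring_spec R)) p :
  range ring_D U -> range ring_D V -> U p -> V p ->
  exists W, [/\ range ring_D W, W p & W `<=` U `&` V].
Proof.
move=> [f _ <-] [g _ <-] pf pg; exists (ring_D (f * g)); split.
- by exists (f * g).
- by rewrite ring_DM.
- by rewrite ring_DM.
Qed.

HB.instance Definition _ :=
  isBaseTopological.Build (ring_spec R) ring_D_cover ring_D_join.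

End RingSpecTopology.

Lemma open_binoid_D (M : binoidType) (f : M) : open (binoid_D f).
Proof. by exists [set binoid_D f]; [move=> _ ->; exists f|rewrite bigcup_set1]. Qed.

Lemma open_ring_D (R : comPzRingType) (f : R) : open (ring_D f).
Proof. by exists [set ring_D f]; [move=> _ ->; exists f|rewrite bigcup_set1]. Qed.

Lemma malgUZ (K : fieldType) (T : choiceType) (c : K) (u : T) :
  << c *g u >> = c *: << u >> :> {malg K[T]}.
Proof.
apply/malgP => k; rewrite mcoeffZ !mcoeffU.
by case: (u == k) => /=; rewrite ?mulr1n ?mulr0n ?mulr1 ?mulr0.
Qed.

(* The elements of M other than infty form the basis, so T^infty = 0 is built in.
   K[M] is only a comPzRingType: it is the zero ring when 0 = infty in M. *)
Definition binoid_algebra (K : fieldType) (M : binoidType) : Type :=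
  {malg K[{m : M | m != infty}]}.

HB.instance Definition _ (K : fieldType) (M : binoidType) :=
  GRing.Lmodule.on (binoid_algebra K M).

(* A bilinear product that adds the exponents of a spanning family of monomials
   is commutative, associative and unital. *)
Section BilinearProduct.
Variables (K : fieldType) (M : binoidType) (V : lmodType K).
Variables (op : V -> V -> V) (e : M -> V) (T0 : Type) (v : T0 -> M).
Hypothesis opDl : forall f g h, op (f + g) h = op f h + op g h.
Hypothesis opDr : forall f g h, op f (g + h) = op f g + op f h.
Hypothesis opZl : forall c f g, op (c *: f) g = c *: op f g.
Hypothesis opZr : forall c f g, op f (c *: g) = c *: op f g.
Hypothesis opM : forall x y, op (e x) (e y) = e (x + y).
Hypothesis ind : forall P : V -> Prop,
  P 0 -> (forall f g, P f -> P g -> P (f + g)) ->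
  (forall c u, P (c *: e (v u))) -> forall f, P f.

Lemma bil0l f : op 0 f = 0.
Proof. by rewrite -(scale0r (0 : V)) opZl !scale0r. Qed.

Lemma bil0r f : op f 0 = 0.
Proof. by rewrite -(scale0r (0 : V)) opZr !scale0r. Qed.

Lemma bilC : commutative op.
Proof.
move=> f g; elim/ind: f => [|f1 f2 IH1 IH2|c u].
- by rewrite bil0l bil0r.
- by rewrite opDl opDr IH1 IH2.
elim/ind: g => [|g1 g2 IH1 IH2|d w].
- by rewrite bil0l bil0r.
- by rewrite opDl opDr IH1 IH2.
by rewrite !(opZl, opZr) !scalerA mulrC !opM addrC.
Qed.

Lemma bilA : associative op.
Proof.
move=> f g h; elim/ind: f => [|f1 f2 IH1 IH2|c u].
- by rewrite !bil0l.
- by rewrite !opDl IH1 IH2.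
elim/ind: g => [|g1 g2 IH1 IH2|d w].
- by rewrite !(bil0l, bil0r).
- by rewrite !(opDl, opDr) IH1 IH2.
elim/ind: h => [|g1 g2 IH1 IH2|k z].
- by rewrite !(bil0l, bil0r).
- by rewrite !(opDl, opDr) IH1 IH2.
by rewrite !(opZl, opZr) !scalerA !opM addrA -(mulrA k c d) (mulrC k).
Qed.

Lemma bil1 : left_id (e 0) op.
Proof.
move=> f; elim/ind: f => [|f1 f2 IH1 IH2|c u].
- by rewrite bil0r.
- by rewrite opDr IH1 IH2.
by rewrite opZr opM add0r.
Qed.

End BilinearProduct.

Section BinoidAlgebra.
Variables (K : fieldType) (M : binoidType).
Local Notation T0 := {m : M | m != infty}.
Local Notation A := (binoid_algebra K M).

Definition bmon (m : M) : A :=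
  if insub m is Some u then (<< (u : T0) >> : {malg K[T0]}) else 0.

(* The linear extension to K[M] of a map h on the basis. *)
Definition bext (V : lmodType K) (h : T0 -> V) (f : A) : V :=
  \sum_(a <- msupp f) f@_a *: h a.

(* The bilinear extension of T^a T^b = T^(a + b). *)
Definition bmul (f g : A) : A :=
  bext (fun a => bext (fun b => bmon (val a + val b)) g) f.

Lemma bmon_infty : bmon infty = 0.
Proof. by rewrite /bmon insubF // eqxx. Qed.

Lemma bmon_val (u : T0) : bmon (val u) = << u >>.
Proof. by rewrite /bmon valK. Qed.

Lemma bextw (V : lmodType K) (h : T0 -> V) (f : A) (d : {fset T0}) :
  (msupp f `<=` d)%fset -> bext h f = \sum_(a <- d) f@_a *: h a.
Proof.
move=> le; rewrite /bext (big_fset_incl _ le) // => a _ /mcoeff_outdom ->.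
by rewrite scale0r.
Qed.

Lemma bextD (V : lmodType K) (h : T0 -> V) (f g : A) :
  bext h (f + g) = bext h f + bext h g.
Proof.
rewrite (bextw h (msuppD_le f g)).
rewrite (bextw h (fsubsetUl (msupp f) (msupp g))).
rewrite (bextw h (fsubsetUr (msupp f) (msupp g))) -big_split /=.
by apply: eq_bigr => a _; rewrite mcoeffD scalerDl.
Qed.

Lemma bextZ (V : lmodType K) (h : T0 -> V) c (f : A) :
  bext h (c *: f) = c *: bext h f.
Proof.
rewrite (bextw h (msuppZ_le c f)) /bext scaler_sumr.
by apply: eq_bigr => a _; rewrite mcoeffZ scalerA.
Qed.

Lemma bext0 (V : lmodType K) (h : T0 -> V) : bext h 0 = 0.
Proof. by rewrite -(scale0r (0 : A)) bextZ scale0r. Qed.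

Lemma bextU (V : lmodType K) (h : T0 -> V) u : bext h (bmon (val u)) = h u.
Proof.
by rewrite bmon_val /bext msuppU oner_eq0 big_seq_fset1 mcoeffUU scale1r.
Qed.

Lemma bext_ind (P : A -> Prop) :
  P 0 -> (forall f g, P f -> P g -> P (f + g)) ->
  (forall c (u : T0), P (c *: bmon (val u))) -> forall f, P f.
Proof.
move=> P0 PD PU f; rewrite [f]monalgE; apply: big_ind => // u _.
by rewrite malgUZ -bmon_val; exact: PU.
Qed.

Lemma bmulDl : left_distributive bmul +%R.
Proof. by move=> f g h; rewrite /bmul bextD. Qed.

Lemma bmulDr f g h : bmul f (g + h) = bmul f g + bmul f h.
Proof.
rewrite /bmul /bext -big_split /=; apply: eq_bigr => a _.
by rewrite -scalerDr -bextD.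
Qed.

Lemma bmulZl c f g : bmul (c *: f) g = c *: bmul f g.
Proof. exact: bextZ. Qed.

Lemma bmulZr c f g : bmul f (c *: g) = c *: bmul f g.
Proof.
rewrite /bmul [in RHS]/bext scaler_sumr; apply: eq_bigr => a _.
by rewrite bextZ !scalerA mulrC.
Qed.

Lemma bmul0l f : bmul 0 f = 0.
Proof. exact: bext0. Qed.

Lemma bmul0r f : bmul f 0 = 0.
Proof. by rewrite -(scale0r (0 : A)) bmulZr !scale0r. Qed.

Lemma bmulM (x y : M) : bmul (bmon x) (bmon y) = bmon (x + y).
Proof.
have [->|xN] := eqVneq x infty.
  by rewrite addrC addr_infty bmon_infty bmul0l.
have [->|yN] := eqVneq y infty; first by rewrite addr_infty bmon_infty bmul0r.
rewrite -[x]/(val (Sub x xN : T0)) -[y]/(val (Sub y yN : T0)).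
by rewrite /bmul !bextU.
Qed.

Lemma bmulC : commutative bmul.
Proof. exact: (bilC bmulDl bmulDr bmulZl bmulZr bmulM bext_ind). Qed.

Lemma bmulA : associative bmul.
Proof. exact: (bilA bmulDl bmulDr bmulZl bmulZr bmulM bext_ind). Qed.

Lemma bmul1 : left_id (bmon 0) bmul.
Proof. exact: (bil1 bmulDr bmulZr bmulM bext_ind). Qed.

HB.instance Definition _ :=
  GRing.Zmodule_isComPzRing.Build (binoid_algebra K M) bmulA bmulC bmul1 bmulDl.

Lemma bmon0 : bmon 0 = 1.
Proof. by []. Qed.

Lemma bmonD (x y : M) : bmon (x + y) = bmon x * bmon y.
Proof. by rewrite -bmulM. Qed.

Lemma bscalerAl (c : K) (f g : A) : c *: (f * g) = (c *: f) * g.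
Proof. exact/esym/bmulZl. Qed.

Definition kspan (I : set M) : set A :=
  [set f | exists (s : seq M) (c : M -> K),
     (forall m, m \in s -> I m) /\ f = \sum_(m <- s) c m *: bmon m].

End BinoidAlgebra.

Arguments bmon K {M} m.
Arguments kspan K {M} I.

(* Why K[p] is prime: a cancellative torsion-free monoid has, for each finite
   subset, a compatible order that is total on it, and the product of the largest
   terms of two polynomials with support outside p cannot cancel. *)
Section MonoidOrder.
Variable N : nmodType.

Record compatible_order (le : N -> N -> Prop) : Prop := CompatibleOrder {
  co_refl : forall x, le x x;
  co_trans : forall x y z, le x y -> le y z -> le x z;
  co_anti : forall x y, le x y -> le y x -> x = y;
  co_add : forall z x y, le x y -> le (x + z) (y + z);
  co_cancel : forall z x y, le (x + z) (y + z) -> le x y;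
  co_sat : forall n x y, le (x *+ n.+1) (y *+ n.+1) -> le x y
}.

Lemma co_addM le x y u v : compatible_order le ->
  le x y -> le u v -> le (x + u) (y + v).
Proof.
move=> co xy uv; apply: (co_trans co) (co_add co u xy) _.
by rewrite ![y + _]addrC; apply: co_add.
Qed.

Lemma co_muln le n x y : compatible_order le -> le x y -> le (x *+ n) (y *+ n).
Proof.
move=> co xy; elim: n => [|n IH]; first by rewrite !mulr0n; apply: co_refl.
by rewrite !mulrS; apply: co_addM.
Qed.

Let ext_le (le : N -> N -> Prop) (x y a b : N) :=
  exists m n, le (a *+ m.+1 + x *+ n) (b *+ m.+1 + y *+ n).

Let ext_le_comp le x y a b c m n m' n' : compatible_order le ->
  le (a *+ m.+1 + x *+ n) (b *+ m.+1 + y *+ n) ->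
  le (b *+ m'.+1 + x *+ n') (c *+ m'.+1 + y *+ n') ->
  le (a *+ (m.+1 * m'.+1) + x *+ (n * m'.+1 + n' * m.+1))
     (c *+ (m.+1 * m'.+1) + y *+ (n * m'.+1 + n' * m.+1)).
Proof.
move=> co /(co_muln m'.+1 co) H1 /(co_muln m.+1 co) H2.
have := co_addM co H1 H2; rewrite !mulrnDl -!mulrnA (mulnC m'.+1 m.+1).
rewrite !mulrnDr => H; apply: (co_cancel co (z := b *+ (m.+1 * m'.+1))).
rewrite addrAC addrACA.
by rewrite [X in le _ X]addrAC (addrC (c *+ _)) [X in le _ X]addrACA.
Qed.

Lemma compatible_order_ext le x y : compatible_order le ->
  exists le', [/\ compatible_order le', (forall a b, le a b -> le' a b) &
                  le' x y \/ le' y x].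
Proof.
move=> co; have [xy|xy] := pselect (le x y).
  by exists le; split=> //; left.
have sub a b : le a b -> ext_le le x y a b.
  by move=> ab; exists 0%N, 0%N; rewrite !mulr0n !addr0.
exists (ext_le le x y); split=> //; last first.
  by right; exists 0%N, 1%N; rewrite !mulr1n addrC; apply: co_refl.
split.
- by move=> a; apply: sub; apply: co_refl.
- move=> a b c [m [n H1]] [m' [n' H2]].
  have := ext_le_comp co H1 H2; rewrite mulSn addSn.
  by exists (m' + m * m'.+1)%N, (n * m'.+1 + n' * m.+1)%N.
- move=> a b [m [n H1]] [m' [n' H2]].
  have := ext_le_comp co H1 H2; rewrite addrC [X in le _ X]addrC.
  move=> /(co_cancel co).
  case E: (n * m'.+1 + n' * m.+1)%N => [|k]; last by move=> /(co_sat co).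
  move: E => /eqP; rewrite addn_eq0 !muln_eq0 !orbF => /andP[/eqP n0 /eqP n'0] _.
  move: H1 H2; rewrite n0 n'0 !mulr0n !addr0.
  by move=> /(co_sat co) ab /(co_sat co); exact: co_anti.
- move=> z a b [m [n H]]; exists m, n; rewrite !mulrnDl.
  rewrite addrAC [X in le _ X]addrAC; exact: co_add.
- move=> z a b [m [n]]; rewrite !mulrnDl.
  by rewrite addrAC [X in le _ X]addrAC => /(co_cancel co) H; exists m, n.
- move=> k a b [m [n]]; rewrite -!mulrnA mulSn addSn => H.
  by exists (m + k * m.+1)%N, n.
Qed.

Hypothesis addIN : forall z x y : N, x + z = y + z -> x = y.
Hypothesis mulnIN : forall n (x y : N), x *+ n.+1 = y *+ n.+1 -> x = y.

Lemma compatible_order_total (s : seq (N * N)) :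
  exists le, compatible_order le /\
    forall q, q \in s -> le q.1 q.2 \/ le q.2 q.1.
Proof.
elim: s => [|[x y] s [le [co H]]].
  by exists eq; split=> //; split=> // [x y z -> //|z x y ->].
have [le' [co' sub xy]] := compatible_order_ext x y co.
exists le'; split=> // q; rewrite inE => /orP[/eqP -> //|/H[] /sub]; first by left.
by right.
Qed.

Lemma seq_has_max (le : N -> N -> Prop) (s : seq N) (x : N) :
  compatible_order le ->
  {in x :: s &, forall y z, le y z \/ le z y} ->
  exists2 m, m \in x :: s & {in x :: s, forall y, le y m}.
Proof.
move=> co; elim: s x => [|y s IH] x tot.
  by exists x => [|y]; rewrite inE // => /eqP ->; apply: co_refl.
have [z w z1 z2|m ms mmax] := IH y.
  by apply: tot; rewrite inE ?z1 ?z2 orbT.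
have mx : m \in x :: y :: s by rewrite inE ms orbT.
have [xm|xm] := tot x m (mem_head _ _) mx.
  by exists m => // z; rewrite inE => /orP[/eqP -> //|/mmax].
exists x => [|z]; first exact: mem_head.
rewrite inE => /orP[/eqP ->|/mmax zm]; first exact: co_refl.
exact: co_trans zm xm.
Qed.

Lemma unique_product (s t : seq N) : (0 < size s)%N -> (0 < size t)%N ->
  exists a b, [/\ a \in s, b \in t &
    {in s & t, forall a' b', a' + b' = a + b -> a' = a /\ b' = b}].
Proof.
case: s t => [|x s] // [|y t] // _ _.
set r := (x :: s) ++ (y :: t).
have [le [co tot]] := compatible_order_total [seq (a, b) | a <- r, b <- r].
have {}tot : {in r &, forall a b, le a b \/ le b a}.
  by move=> a b ar br; apply: (tot (a, b)); apply/allpairsP; exists (a, b).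
have [a as_ amax] : exists2 a, a \in x :: s & {in x :: s, forall c, le c a}.
  apply: seq_has_max => // c d cs ds.
  by apply: tot; rewrite mem_cat ?cs ?ds.
have [b bt bmax] : exists2 b, b \in y :: t & {in y :: t, forall c, le c b}.
  apply: seq_has_max => // c d cs ds.
  by apply: tot; rewrite mem_cat ?cs ?ds orbT.
exists a, b; split=> // a' b' /amax aa /bmax bb E.
suff ea : a' = a.
  split=> //; move: E; rewrite ea ![a + _]addrC; exact: addIN.
apply: (co_anti co) => //; apply: (co_cancel co (z := b)).
rewrite -E ![a' + _]addrC; exact: co_add.
Qed.

End MonoidOrder.

Section Face.
Variables (M : binoidType) (p : binoid_spec M).

Definition face := {x : M | `[< ~ p x >]}.
HB.instance Definition _ := Choice.on face.

Lemma binoid_spec_add (x y : M) : p (x + y) <-> p x \/ p y.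
Proof.
have [[_ pI] _ pp] := binoid_specP p; split=> [/pp //|[]]; last exact: pI.
by rewrite addrC; exact: pI.
Qed.

Lemma face_n (x : face) : ~ p (val x).
Proof. by apply/asboolP; exact: (valP x). Qed.

Let fin (x : M) (xp : ~ p x) : face := exist _ x (asboolT xp).

Definition face0 : face := fin (@binoid_prime_n0 M p).

Fact face_add_subproof (x y : face) : ~ p (val x + val y).
Proof. by move=> /binoid_spec_add[]; exact: face_n. Qed.

Definition face_add (x y : face) : face := fin (@face_add_subproof x y).

Fact face_addA : associative face_add.
Proof. by move=> x y z; apply/val_inj; rewrite /= addrA. Qed.
Fact face_addC : commutative face_add.
Proof. by move=> x y; apply/val_inj; rewrite /= addrC. Qed.
Fact face_add0 : left_id face0 face_add.
Proof. by move=> x; apply/val_inj; rewrite /= add0r. Qed.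

HB.instance Definition _ :=
  GRing.isNmodule.Build face face_addA face_addC face_add0.

Lemma face_valD (x y : face) : val (x + y) = val x + val y.
Proof. by []. Qed.

Lemma face_valMn (x : face) n : val (x *+ n) = val x *+ n.
Proof. by elim: n => // n IH; rewrite !mulrS face_valD IH. Qed.

Lemma face_neq_infty (x : face) : val x <> infty.
Proof.
by move=> x0; apply: (@face_n x); rewrite x0; have [[]] := binoid_specP p.
Qed.

Lemma face_addI : cancellative M ->
  forall z x y : face, x + z = y + z -> x = y.
Proof.
move=> cM z x y /(congr1 val); rewrite !face_valD => E; apply/val_inj.
apply: (cM (val z)); first by rewrite ![val z + _]addrC.
rewrite addrC -face_valD; exact: face_neq_infty.
Qed.

Lemma face_mulnI : torsion_free M ->
  forall n (x y : face), x *+ n.+1 = y *+ n.+1 -> x = y.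
Proof.
move=> tM n x y /(congr1 val); rewrite !face_valMn => E; apply/val_inj.
by apply: (tM n.+1) => //; rewrite -face_valMn; exact: face_neq_infty.
Qed.

End Face.

Section SpecMap.
Variables (K : fieldType) (M : binoidType).
Local Notation A := (binoid_algebra K M).
Local Notation T0 := {m : M | m != infty}.

Lemma mcoeff_bmon (m : M) (u : T0) : (bmon K m)@_u = (m == val u)%:R.
Proof.
rewrite /bmon; case: insubP => [v _ <-|].
  by rewrite mcoeffU (inj_eq val_inj).
rewrite negbK => /eqP ->; rewrite mcoeff0; case: eqP => // E.
by have := valP u; rewrite -E eqxx.
Qed.

Lemma kspanP (I : set M) (f : A) :
  kspan K I f <-> forall u : T0, f@_u != 0 -> I (val u).
Proof.
split=> [[s [c [sI ->]]] u|fI].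
  rewrite raddf_sum /= => H; apply: contrapT => uI; move/eqP: H; apply.
  rewrite big_seq big1 // => m /sI mI; rewrite mcoeffZ mcoeff_bmon.
  by case: eqP => [mu|_]; rewrite ?mulr0 //; case: uI; rewrite -mu.
exists (map val (msupp f)), (fun m => if insub m is Some u then f@_u else 0).
split=> [m /mapP[u uf ->]|]; first by apply: fI; rewrite mcoeff_neq0.
rewrite big_map [LHS]monalgE; apply: eq_bigr => u _; rewrite valK bmon_val.
exact: malgUZ.
Qed.

Lemma mcoeffM (f g : A) (u : T0) : (f * g)@_u =
  \sum_(a <- msupp f) \sum_(b <- msupp g)
     f@_a * g@_b * (val a + val b == val u)%:R.
Proof.
rewrite /GRing.mul /= /bmul /bext raddf_sum /=; apply: eq_bigr => a _.
rewrite mcoeffZ raddf_sum /= big_distrr /=; apply: eq_bigr => b _.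
by rewrite mcoeffZ mcoeff_bmon mulrA.
Qed.

Lemma kspan_ideal (I : set M) : binoid_ideal I -> ring_ideal (kspan K I).
Proof.
move=> [_ IM]; split.
- by apply/kspanP => u; rewrite mcoeff0 eqxx.
- move=> f g /kspanP fI /kspanP gI; apply/kspanP => u; rewrite mcoeffD => fg.
  have [f0|/fI //] := eqVneq f@_u 0; apply: gI.
  by move: fg; rewrite f0 add0r.
- move=> f g /kspanP gI; apply/kspanP => u; rewrite mcoeffM => H.
  apply: contrapT => uI; move/eqP: H; apply.
  apply: big1 => a _; rewrite big_seq big1 // => b; rewrite -mcoeff_neq0 => /gI bI.
  by case: eqP => [ab|_]; rewrite ?mulr0 //; case: uI; rewrite -ab; apply: IM.
Qed.

Hypothesis cM : cancellative M.
Hypothesis tM : torsion_free M.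

Lemma kspan_prime (p : binoid_spec M) : ring_prime (kspan K p).
Proof.
split; first by apply: kspan_ideal; case: (binoid_specP p).
  move=> pT; have : kspan K p 1 by rewrite pT.
  have n0 : (0 : M) != infty.
    by apply/eqP => E; apply: (@binoid_prime_n0 _ p); rewrite E; case: (binoid_specP p) => -[].
  move=> /kspanP /(_ (Sub 0 n0)); rewrite -(bmon0 K M) mcoeff_bmon /= eqxx.
  by rewrite oner_eq0 => /(_ isT); exact: binoid_prime_n0.
move=> f g /kspanP fg; apply: contrapT => /not_orP[].
pose S (h : A) : seq (face p) := pmap insub (map val (msupp h)).
have memS (h : A) (x : face p) :
    x \in S h -> exists2 u : T0, val u = val x & h@_u != 0.
  rewrite mem_pmap_sub => /mapP[u uh E]; exists u; first by rewrite -E.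
  by rewrite mcoeff_neq0.
have inS (h : A) (u : T0) (x : face p) : u \in msupp h -> val u = val x -> x \in S h.
  by move=> uh E; rewrite mem_pmap_sub; apply/mapP; exists u.
have S0 (h : A) : ~ kspan K p h -> (0 < size (S h))%N.
  move=> hp; case E: (S h) => [|//]; exfalso; apply: hp; apply/kspanP => u hu.
  apply: contrapT => pu.
  have : (exist _ (val u) (asboolT pu) : face p) \in S h.
    by apply: (inS h u) => //; rewrite -mcoeff_neq0.
  by rewrite E.
move=> /S0 f0 /S0 g0.
have [a [b [af bg uniqab]]] :=
  unique_product (face_addI cM) (face_mulnI tM) f0 g0.
have abN : val a + val b != infty by apply/eqP; exact: (@face_neq_infty _ _ (a + b)).
apply: (@face_n _ _ (a + b)).
apply: (fg (Sub (val a + val b) abN)).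
have [u ua fu] := memS _ _ af; have [v vb gv] := memS _ _ bg.
rewrite mcoeffM (bigD1_seq u) ?fset_uniq -?mcoeff_neq0 //=.
rewrite (bigD1_seq v) ?fset_uniq -?mcoeff_neq0 //= ua vb eqxx mulr1.
have key u' v' : u' \in msupp f -> v' \in msupp g ->
    val u' + val v' == val a + val b -> u' = u /\ v' = v.
  move=> u'f v'g /eqP E.
  have npuv : ~ p (val u' + val v') by rewrite E; exact: (@face_n _ _ (a + b)).
  have npu : ~ p (val u') by move=> H; apply: npuv; apply/binoid_spec_add; left.
  have npv : ~ p (val v') by move=> H; apply: npuv; apply/binoid_spec_add; right.
  pose a' : face p := exist _ (val u') (asboolT npu).
  pose b' : face p := exist _ (val v') (asboolT npv).
  have E' : a' + b' = a + b by apply: val_inj; exact: E.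
  have [||aa bb] := uniqab a' b' _ _ E'.
  - exact: (inS f u' a' u'f).
  - exact: (inS g v' b' v'g).
  by split; apply: val_inj; [rewrite ua -aa|rewrite vb -bb].
rewrite big_seq_cond big1 ?addr0 => [|v' /andP[v'g v'v]]; last first.
  case: eqP; rewrite ?mulr0 // => /eqP E.
  have uf : u \in msupp f by rewrite -mcoeff_neq0.
  rewrite -ua in E; by have [_ /eqP] := key _ _ uf v'g E; rewrite (negPf v'v).
rewrite big_seq_cond big1 ?addr0 => [|u' /andP[u'f u'u]]; last first.
  rewrite big_seq big1 // => v' v'g; case: eqP; rewrite ?mulr0 // => /eqP E.
  by have [/eqP] := key _ _ u'f v'g E; rewrite (negPf u'u).
by rewrite mulf_neq0.
Qed.

Definition spec_incl (p : binoid_spec M) : ring_spec A :=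
  RingSpec (kspan_prime p).

Lemma spec_incl_D (f : A) :
  spec_incl @^-1` ring_D f = \bigcup_(u in [set` msupp f]) binoid_D (val u).
Proof.
apply/seteqP; split=> p /=.
  move=> fp; apply: contrapT => H; apply: fp; apply/kspanP => u fu.
  by apply: contrapT => pu; apply: H; exists u => //=; rewrite -mcoeff_neq0.
move=> [u /= uf pu] /kspanP fp; apply: pu; apply: fp.
by rewrite mcoeff_neq0.
Qed.

Lemma spec_incl_continuous : continuous spec_incl.
Proof.
apply/continuousP => _ [D DR <-]; rewrite preimage_bigcup.
apply: bigcup_open => U /DR[f _ <-]; rewrite spec_incl_D.
by apply: bigcup_open => u _; exact: open_binoid_D.
Qed.

End SpecMap.

Arguments spec_incl K {M} cM tM p.
Arguments spec_incl_continuous K {M} cM tM.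

Record opens (X : topologicalType) := Opens {
  opens_set :> X -> Prop;
  opensP : open (opens_set : set X)
}.

Definition opensI (X : topologicalType) (U V : opens X) : opens X :=
  Opens (openI (opensP U) (opensP V)).

Definition opens_preimage (X Y : topologicalType) (phi : X -> Y)
    (cphi : continuous phi) (V : opens Y) : opens X :=
  Opens (proj1 (continuousP phi) cphi _ (opensP V)).

Definition opens_sub (X : topologicalType) (V U : opens X) : Prop :=
  (V : set X) `<=` U.

Lemma opensIl (X : topologicalType) (U V : opens X) : opens_sub (opensI U V) U.
Proof. exact: subIsetl. Qed.
Arguments opensIl {X} U V.

Lemma opensIr (X : topologicalType) (U V : opens X) : opens_sub (opensI U V) V.
Proof. exact: subIsetr. Qed.
Arguments opensIr {X} U V.

Section Sheaves.
Variable X : topologicalType.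

(* Restriction maps take the inclusion as a proof; quantifying the laws over all
   such proofs makes them irrelevant. *)
Record presheaf := Presheaf {
  sections :> opens X -> zmodType;
  res : forall V U : opens X, opens_sub V U -> {additive sections U -> sections V};
  res_id : forall (U : opens X) (h : opens_sub U U) (s : sections U),
    res h s = s;
  res_comp : forall (W V U : opens X)
    (hWV : opens_sub W V) (hVU : opens_sub V U) (hWU : opens_sub W U)
    (s : sections U), res hWV (res hVU s) = res hWU s
}.

Definition is_sheaf (F : presheaf) :=
  forall (U : opens X) (I : Type) (V : I -> opens X)
    (hV : forall i, opens_sub (V i) U),
    (U : set X) `<=` \bigcup_(i in [set: I]) (V i : set X) ->
  forall s : forall i, F (V i),
    (forall i j,
       res F (opensIl (V i) (V j)) (s i) = res F (opensIr (V i) (V j)) (s j)) ->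
  exists! t : F U, forall i, res F (hV i) t = s i.

Record sheaf := Sheaf {
  sheaf_presheaf :> presheaf;
  sheafP : is_sheaf sheaf_presheaf
}.

Record sheaf_hom (F G : sheaf) := SheafHom {
  sheaf_hom_fun :> forall U : opens X, {additive F U -> G U};
  sheaf_hom_nat : forall (V U : opens X) (h : opens_sub V U) (s : F U),
    sheaf_hom_fun V (res F h s) = res G h (sheaf_hom_fun U s)
}.

Definition ker_sheaf (F G : sheaf) (f : sheaf_hom F G) (U : opens X) :
  set (F U) := [set s | f U s = 0].
Arguments ker_sheaf {F G} f U.

(* The image sheaf, as a subsheaf of G: the sections that lie locally in the
   image of f. *)
Definition im_sheaf (F G : sheaf) (f : sheaf_hom F G) (U : opens X) :
  set (G U) := [set t | forall x, U x ->
    exists (V : opens X) (h : opens_sub V U),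
      V x /\ exists s : F V, f V s = res G h t].
Arguments im_sheaf {F G} f U.

(* Exactness of 0 -> F -> G -> H -> 0. *)
Definition short_exact (F G H : sheaf) (f : sheaf_hom F G) (g : sheaf_hom G H) :=
  [/\ forall U : opens X, ker_sheaf f U = [set 0],
      forall U : opens X, im_sheaf f U = ker_sheaf g U &
      forall U : opens X, im_sheaf g U = setT].

End Sheaves.

Arguments res {X} p {V U} h.

Section Pushforward.
Variables (X Y : topologicalType) (phi : X -> Y) (cphi : continuous phi).
Local Notation pre := (opens_preimage cphi).

Lemma opens_preimage_sub (V U : opens Y) :
  opens_sub V U -> opens_sub (pre V) (pre U).
Proof. by move=> h x; exact: h. Qed.

Definition pushforward_presheaf (F : presheaf X) : presheaf Y.
Proof.
refine (@Presheaf Y (fun V => F (pre V))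
  (fun V U h => res F (opens_preimage_sub h)) _ _).
- by move=> U h s; exact: res_id.
- by move=> W V U h1 h2 h3 s; exact: res_comp.
Defined.

Lemma pushforward_is_sheaf (F : sheaf X) : is_sheaf (pushforward_presheaf F).
Proof.
move=> U I V hV cov s comp.
have cov' : (pre U : set X) `<=` \bigcup_(i in [set: I]) (pre (V i) : set X).
  by move=> x /cov[i _ Vx]; exists i.
have comp' i j : res F (opensIl (pre (V i)) (pre (V j))) (s i) =
                 res F (opensIr (pre (V i)) (pre (V j))) (s j).
  have sub : opens_sub (opensI (pre (V i)) (pre (V j))) (pre (opensI (V i) (V j))).
    by move=> x.
  rewrite -(res_comp sub (opens_preimage_sub (opensIl (V i) (V j)))).
  rewrite -(res_comp sub (opens_preimage_sub (opensIr (V i) (V j)))).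
  by congr (res F sub _); exact: comp.
exact: (sheafP (fun i => opens_preimage_sub (hV i)) cov' comp').
Qed.

Definition pushforward (F : sheaf X) : sheaf Y := Sheaf (@pushforward_is_sheaf F).

Definition pushforward_hom (F G : sheaf X) (f : sheaf_hom F G) :
  sheaf_hom (pushforward F) (pushforward G).
Proof.
refine (@SheafHom Y (pushforward F) (pushforward G) (fun V => f (pre V)) _).
by move=> V U h s; exact: (sheaf_hom_nat f (opens_preimage_sub h) s).
Defined.

End Pushforward.

(* Main.v *)
Require Import Defs.
From mathcomp Require Import all_boot all_order all_algebra.
From mathcomp Require Import boolp classical_sets topology.

(** Left exactness holds for every pushforward. For surjectivity, let P be a
    prime of K[M] and p := {m | T^m in P}, a prime of M. Every open set around P
    contains K[p], and if m is the sum of the generators of M outside p, then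
    D(m) = {q | q contained in p} lies in every open set around p. So a section
    that lifts near p lifts on the preimage of a neighbourhood of P inside
    D(T^m). *)

Set Implicit Arguments.
Unset Strict Implicit.
Unset Printing Implicit Defensive.

Import GRing.Theory.

Local Open Scope classical_set_scope.
Local Open Scope ring_scope.

Lemma sheaf_separated (X : topologicalType) (F : sheaf X) (U : opens X)
    (I : Type) (V : I -> opens X) (hV : forall i, opens_sub (V i) U)
    (s t : F U) :
  (U : set X) `<=` \bigcup_(i in [set: I]) (V i : set X) ->
  (forall i, res F (hV i) s = res F (hV i) t) -> s = t.
Proof.
move=> cov st.
(* Both [s] and [t] glue the restrictions of [t], and gluings are unique. *)
have [|u [_ uniq_u]] := @sheafP _ F U I V hV cov (fun i => res F (hV i) t).
  move=> i j.
  have hij : opens_sub (opensI (V i) (V j)) U by move=> x [/hV].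
  by rewrite !(res_comp _ _ hij).
by rewrite -(uniq_u s st) (uniq_u t).
Qed.

Lemma sheaf_hom_ker0_inj (X : topologicalType) (F G : sheaf X)
    (f : sheaf_hom F G) (U : opens X) :
  ker_sheaf f (U := U) = [set 0] -> injective (f U).
Proof.
move=> kerf s t st; apply/eqP; rewrite -subr_eq0; apply/eqP.
have : ker_sheaf f (U := U) (s - t) by rewrite /ker_sheaf /= raddfB st subrr.
by rewrite kerf.
Qed.

(** Injectivity makes local preimages unique, so they agree on overlaps and glue. *)
Lemma im_sheaf_inj (X : topologicalType) (F G : sheaf X) (f : sheaf_hom F G)
    (finj : forall U, injective (f U)) (U : opens X) (t : G U) :
  im_sheaf f t -> exists s, f U s = t.
Proof.
move=> imt.
(* The cover is indexed by the points of [U], with one neighbourhood chosen for each. *)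
have lift (x : {x | U x}) : exists V : {V : opens X | opens_sub V U},
    proj1_sig V (proj1_sig x) /\
    exists s : F (proj1_sig V), f _ s = res G (proj2_sig V) t.
  by have [V [h [Vx sP]]] := imt _ (proj2_sig x); exists (exist _ V h).
have [V VP] := boolp.choice lift.
pose W x := proj1_sig (V x); pose hW x := proj2_sig (V x) : opens_sub (W x) U.
have cov : (U : set X) `<=` \bigcup_(x in [set: {x | U x}]) (W x : set X).
  by move=> x Ux; exists (exist _ x Ux) => //; exact: (proj1 (VP (exist _ x Ux))).
pose s x := projT1 (cid (proj2 (VP x))) : F (W x).
have sP x : f _ (s x) = res G (hW x) t := projT2 (cid (proj2 (VP x))).
have [|u [uP _]] := @sheafP _ F U _ W hW cov s.
  move=> x y; apply: finj; rewrite !sheaf_hom_nat !sP.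
  have hxy : opens_sub (opensI (W x) (W y)) U by move=> z [/hW].
  by rewrite !(res_comp _ _ hxy).
exists u; apply: (sheaf_separated (hV := hW)) => // x.
by rewrite -sheaf_hom_nat uP sP.
Qed.

Section PushforwardExact.
Variables (X Y : topologicalType) (phi : X -> Y) (cphi : continuous phi).

(** Neighbourhoods in [Y] pull back to [X], which gives one inclusion. For the other, [f] is
    injective, so a section killed by [g] lifts on the whole preimage of [V]. *)
Lemma pushforward_left_exact (F G H : sheaf X)
    (f : sheaf_hom F G) (g : sheaf_hom G H) :
  (forall U, ker_sheaf f (U := U) = [set 0]) ->
  (forall U, im_sheaf f (U := U) = ker_sheaf g (U := U)) ->
  forall V, im_sheaf (pushforward_hom cphi f) (U := V) =
            ker_sheaf (pushforward_hom cphi g) (U := V).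
Proof.
move=> kerf imf V; apply/seteqP; split=> t; rewrite /ker_sheaf /=.
  move=> imt; suff : im_sheaf f (U := opens_preimage cphi V) t by rewrite imf.
  move=> x /imt[W [h [Wx [s sP]]]].
  exists (opens_preimage cphi W), (@opens_preimage_sub _ _ _ cphi _ _ h).
  by split=> //; exists s.
move=> gt; have : im_sheaf f (U := opens_preimage cphi V) t by rewrite imf.
have finj U := sheaf_hom_ker0_inj (kerf U).
move=> /(im_sheaf_inj finj)[s sP] y Vy.
have h : opens_sub V V by [].
by exists V, h; split=> //; exists s; rewrite [LHS]sP [RHS]res_id.
Qed.

(* The hypothesis makes the stalk of a pushforward at y the stalk at x. *)
Lemma pushforward_im_setT (G H : sheaf X) (g : sheaf_hom G H) :
  (forall y : Y, exists (x : X) (W : opens Y),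
    [/\ W y, forall V : opens Y, V y -> V (phi x) &
        forall U : opens X, U x -> phi @^-1` W `<=` U]) ->
  (forall U, im_sheaf g (U := U) = setT) ->
  forall V, im_sheaf (pushforward_hom cphi g) (U := V) = setT.
Proof.
move=> centre img V; apply/seteqP; split=> // t _ y Vy.
have [x [W [Wy spec_x min_x]]] := centre y.
have : im_sheaf g (U := opens_preimage cphi V) t by rewrite img.
move=> /(_ x (spec_x V Vy))[U [h [Ux [s sP]]]].
(* Shrinking [V] to its intersection with [W] pulls back into the domain [U] of the lift [s]. *)
have hU : opens_sub (opens_preimage cphi (opensI V W)) U.
  by move=> z [_ Wz]; exact: (min_x U Ux).
exists (opensI V W), (opensIl V W); split=> //; exists (res G hU s).
rewrite [LHS]sheaf_hom_nat sP.
exact: (res_comp _ _ (@opens_preimage_sub _ _ _ cphi _ _ (opensIl V W))).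
Qed.

End PushforwardExact.

(** Open sets are stable under generization, since each basic open set is. *)
Lemma binoid_open_sub (M : binoidType) (U : set (binoid_spec M))
    (p q : binoid_spec M) : open U -> U p -> (q : set M) `<=` p -> U q.
Proof.
move=> [D DR <-] [B DB pB] qp; exists B => //.
by case: (DR _ DB) pB => m _ <- pm /qp.
Qed.

Lemma ring_open_sub (R : comPzRingType) (U : set (ring_spec R))
    (p q : ring_spec R) : open U -> U p -> (q : set R) `<=` p -> U q.
Proof.
move=> [D DR <-] [B DB pB] qp; exists B => //.
by case: (DR _ DB) pB => m _ <- pm /qp.
Qed.

(** Primality extended to finite sums; the empty sum is 0, which no prime contains. *)
Lemma binoid_spec_sum (M : binoidType) (p : binoid_spec M) (s : seq M)
    (P : pred M) (h : M -> M) :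
  p (\sum_(a <- s | P a) h a) <-> exists a, [/\ a \in s, P a & p (h a)].
Proof.
elim: s => [|b s IH].
  by rewrite big_nil; split=> [/binoid_prime_n0 //|[a []]].
rewrite big_cons; split.
  case: ifP => [Pb /binoid_spec_add[pb|/IH]|_ /IH].
  - by exists b; rewrite inE eqxx.
  - by move=> [a [? ? ?]]; exists a; rewrite inE (_ : a \in s) ?orbT.
  - by move=> [a [? ? ?]]; exists a; rewrite inE (_ : a \in s) ?orbT.
move=> [a []]; rewrite inE => /predU1P[->|sa] Pa pa.
  by rewrite Pa; apply/binoid_spec_add; left.
have ps : p (\sum_(a <- s | P a) h a) by apply/IH; exists a.
by case: ifP => // _; apply/binoid_spec_add; right.
Qed.

Lemma binoid_spec_mulrn (M : binoidType) (p : binoid_spec M) (a : M) n :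
  p (a *+ n) -> p a.
Proof.
elim: n => [/binoid_prime_n0 //|n IH].
by rewrite mulrS => /binoid_spec_add[].
Qed.

(** An element of [q] has a generator in [q] among its summands, and if [q] avoids [m] that
    generator lies in [p]. *)
Lemma finitely_generated_min_D (M : binoidType) (p : binoid_spec M) :
  finitely_generated M ->
  exists2 m, ~ p m & forall q : binoid_spec M, ~ q m -> (q : set M) `<=` p.
Proof.
move=> [s gen]; exists (\sum_(a <- s | ~~ `[< p a >]) a).
  by move=> /binoid_spec_sum[a [_ /asboolPn]].
move=> q qm x; have [->|/eqP xN] := eqVneq x infty.
  by case: (binoid_specP p) => -[].
have [c ->] := gen x xN => /binoid_spec_sum[a [sa _ qa]].
apply/binoid_spec_sum; exists a; split=> //.
(* The coefficient is positive because 0 is not in [q]. *)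
move: qa; case: (c a) => [/binoid_prime_n0 //|n qa].
rewrite mulrS; apply/binoid_spec_add; left; apply: contrapT => pa.
apply: qm; apply/binoid_spec_sum; exists a; split=> //; first exact/asboolPn.
exact: binoid_spec_mulrn qa.
Qed.

Section MonomialPreimage.
Variables (K : fieldType) (M : binoidType).
Variable P : ring_spec (binoid_algebra K M).

Fact bmon_preimage_prime : binoid_prime [set m : M | P (bmon K m)].
Proof.
have [[P0 _ PM] _ Pp] := ring_specP P; split.
- split=> [|a x Px]; rewrite /= ?bmon_infty // bmonD; exact: PM.
- move=> PT; have : P (bmon K (0 : M)).
    by have : [set m : M | P (bmon K m)] 0 by rewrite PT.
  by rewrite bmon0; exact: ring_prime_n1.
- by move=> a b /=; rewrite bmonD; exact: Pp.
Qed.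

Definition bmon_preimage : binoid_spec M := BinoidSpec bmon_preimage_prime.

Lemma kspan_bmon_preimage_sub : kspan K bmon_preimage `<=` P.
Proof.
have [[P0 PD PM] _ _] := ring_specP P.
move=> _ [s [c [sP ->]]]; rewrite big_seq.
apply: (big_ind (fun h => P h)) => // m /sP Pm.
(* The scalar is absorbed into a ring factor [c m *: 1], as ideals are closed under ring
   multiplication. *)
by rewrite -[bmon K m]mul1r bscalerAl; exact: PM.
Qed.

End MonomialPreimage.

Theorem theorem3p30 (K : fieldType) (M : binoidType)
    (fgM : finitely_generated M) (tM : torsion_free M) (cM : cancellative M)
    (F G H : sheaf (binoid_spec M)) (f : sheaf_hom F G) (g : sheaf_hom G H) :
  short_exact f g ->
  short_exact (pushforward_hom (spec_incl_continuous K cM tM) f)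
              (pushforward_hom (spec_incl_continuous K cM tM) g).
Proof.
move=> [kerf imf img]; split.
(* Sections over [V] are sections over its preimage, so kernels are computed there. *)
- by move=> V; exact: kerf.
- exact: pushforward_left_exact.
apply: pushforward_im_setT img => P.
have [m Pm min_m] := finitely_generated_min_D (bmon_preimage P) fgM.
exists (bmon_preimage P), (Opens (open_ring_D (bmon K m))); split=> //.
- by move=> V VP; apply: (ring_open_sub (opensP V) VP); exact: kspan_bmon_preimage_sub.
- move=> U UP q Dq; apply: binoid_open_sub (opensP U) UP (min_m q _) => qm; apply: Dq.
  (* If [m] were in [q], then T^m would lie in K[q], as a one-term combination. *)
  exists [:: m], (fun=> 1); split=> [x|]; first by rewrite inE => /eqP ->.
  by rewrite big_seq1 scale1r.
Qed.
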